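(* Let $k \ge 1$ be an integer and let $G$ be a connected $k$-SI graph with at least two vertices, of order $n(G)$, size $m(G)$, and maximum degree $\Delta(G)$. Suppose that $G \not\cong K_{\Delta(G), \Delta(G)-k}$ and $\gcd(\Delta(G), k) = 1$. Then $$m(G) \le (\Delta(G) - k)(n(G) - \Delta(G) + k - 1).$$ Moreover, equality holds if and only if $C_d(G) = 3$ and $|X| = \Delta(G) - k + 1$, where $X$ is the part of the bipartition of $G$ that contains a vertex of maximum degree.
   Context: Graphs are finite and simple. For a positive integer $k$, a graph $G$ is a $k$-stepwise irregular graph ($k$-SI graph) if $|d_G(u) - d_G(v)| = k$ for every edge $uv \in E(G)$, where $d_G(x)$ is the degree of $x$ in $G$. Every $k$-SI graph is bipartite, and in a connected $k$-SI graph with at least two vertices all vertices of maximum degree lie in the same part of the (unique) bipartition. The order $n(G)$ is the number of vertices and the size $m(G)$ is the number of edges. The degree complexity $C_d(G)$ is the number of distinct vertex degrees occurring in $G$. $K_{p,q}$ denotes the complete bipartite graph with parts of sizes $p$ and $q$. *)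

(* Defs.v *)
From mathcomp Require Import all_boot all_order all_algebra.

Set Implicit Arguments.
Unset Strict Implicit.
Unset Printing Implicit Defensive.

Definition simple_graph (T : finType) (e : rel T) : Prop :=
  symmetric e /\ irreflexive e.

Definition connected_graph (T : finType) (e : rel T) : Prop :=
  forall x y : T, connect e x y.

Definition deg (T : finType) (e : rel T) (x : T) : nat := #|[set y | e x y]|.

Definition max_deg (T : finType) (e : rel T) : nat := \max_(x : T) deg e x.

Definition edges (T : finType) (e : rel T) : {set {set T}} :=
  [set E | [exists x, exists y, e x y && (E == [set x; y])]].

(* The difference is taken in int, since nat subtraction truncates. *)
Definition k_SI (k : nat) (T : finType) (e : rel T) : Prop :=
  forall u v : T, e u v -> (`|(deg e u)%:Z - (deg e v)%:Z| = k%:Z)%R.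

Definition deg_complexity (T : finType) (e : rel T) : nat :=
  size (undup [seq deg e x | x : T]).

Definition complete_bipartite (p q : nat) : rel ('I_p + 'I_q) :=
  fun x y => match x, y with
             | inl _, inr _ | inr _, inl _ => true
             | _, _ => false
             end.

Definition graph_iso (T U : finType) (e : rel T) (f : rel U) : Prop :=
  exists2 h : T -> U, bijective h & forall x y : T, f (h x) (h y) = e x y.

(* The two parts are X and ~: X.  In a connected graph this determines the   *)
(* unordered pair {X, ~: X}.                                                 *)
Definition bipartition_part (T : finType) (e : rel T) (X : {set T}) : Prop :=
  forall x y : T, e x y -> (x \in X) != (y \in X).

(* Main.v *)
Require Import Defs.
From mathcomp Require Import all_boot all_order all_algebra.
From mathcomp Require Import zify.

Set Implicit Arguments.
Unset Strict Implicit.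
Unset Printing Implicit Defensive.

(** Along an edge the degree changes by exactly [k], so by connectedness every
    degree has the form [D - j * k]; call [j] the level of the vertex.  Levels
    of adjacent vertices differ by one, so the part [X] of a vertex of degree
    [D] consists of the vertices of even level, and vertices outside [X] have
    degree at most [D - k].  Counting edges from outside [X] gives
    [m <= (D - k) * (n - #|X|)].  A neighbour of a vertex of degree [D] has
    [D - k] neighbours in [X], hence [#|X| >= D - k], and equality would force
    all vertices of level 1, then all of [X], then the whole graph to be
    completely joined, i.e. a complete bipartite graph.  In the equality case
    all vertices outside [X] have level 1, so [X] has levels 0 and 2 only; if
    level 2 did not occur, double counting would give
    [D * (D - k + 1) = (D - k) * (n - #|X|)], so [D - k = 1] by coprimality;
    then the vertices outside [X] are leaves, [G] is a star and [#|X| = 1], a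
    contradiction. *)

(** * Counting edges in bipartite graphs *)

Section Bipartition.
Context (T : finType) (e : rel T).
Hypothesis e_sym : symmetric e.

Lemma bipartition_partC (X : {set T}) :
  bipartition_part e X -> bipartition_part e (~: X).
Proof. by move=> bX x y /bX; rewrite !inE; do 2!case: (_ \in X). Qed.

(** Every edge has exactly one end in [X], so edges correspond to ordered pairs of adjacent vertices
    with first entry in [X]. *)
Lemma card_edges_bipartition (X : {set T}) :
  bipartition_part e X -> #|edges e| = \sum_(x in X) deg e x.
Proof.
move=> bX; pose A := [set p : T * T | (p.1 \in X) && e p.1 p.2].
have injA : {in A &, injective (fun p : T * T => [set p.1; p.2])}.
  case=> [a b] [c d]; rewrite !inE /= => /andP[aX eab] /andP[cX ecd] E.
  have := bX _ _ eab; have := bX _ _ ecd; rewrite aX cX => dX bX'.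
  have /set2P ac : a \in [set c; d] by rewrite -E set21.
  have /set2P bd : b \in [set c; d] by rewrite -E set22.
  case: ac => [->|ad]; last by rewrite -ad aX in dX.
  by case: bd => [bc|->//]; rewrite bc cX in bX'.
have -> : edges e = [set [set p.1; p.2] | p in A].
  apply/setP => E; apply/idP/imsetP => [|[[x y]]]; rewrite inE.
    case/existsP => x /existsP[y /andP[exy /eqP ->]].
    have := bX _ _ exy; have [xX _|xX /= yX] := boolP (x \in X).
      by exists (x, y); rewrite // inE /= xX.
    exists (y, x); last by rewrite /= setUC.
    by rewrite inE /= e_sym exy andbT; case: (y \in X) yX.
  case/andP => /= _ exy ->.
  by rewrite inE; apply/existsP; exists x; apply/existsP; exists y; rewrite exy eqxx.
rewrite (card_in_imset injA) -sum1_card (eq_bigl (fun p => (p.1 \in X) && e p.1 p.2)).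
  rewrite -(pair_big_dep (fun x => x \in X) (fun x y => e x y) (fun _ _ => 1)) /=.
  by apply: eq_bigr => x _; rewrite /deg -sum1_card; apply: eq_bigl => y; rewrite inE.
by move=> p; rewrite inE.
Qed.

End Bipartition.

(** * Connectedness *)

Section Connected.
Context (T : finType) (e : rel T).
Hypothesis e_conn : connected_graph e.

Lemma connected_ind (P : T -> Prop) (v : T) :
  P v -> (forall x y, e x y -> P x -> P y) -> forall x, P x.
Proof.
move=> Pv Pe x; have /connectP[p ep ->] := e_conn v x.
by elim: p v Pv ep => //= y p IHp v Pv /andP[evy]; apply: IHp; apply: Pe evy Pv.
Qed.

Lemma connected_neighbor (x : T) : 2 <= #|T| -> exists y, e x y.
Proof.
move=> T2; have /card_gt0P[y] : 0 < #|predC1 x|.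
  by have := cardC1 x; lia.
rewrite !inE => yx; have /connectP[[|z p] /=] := e_conn x y.
  by move=> _ yx'; rewrite yx' eqxx in yx.
by case/andP => exz _ _; exists z.
Qed.

(** Membership in [X] and in [Z] agree at [v], and both flip along every edge. *)
Lemma bipartition_part_unique (X Z : {set T}) (v : T) :
  bipartition_part e X -> bipartition_part e Z ->
  v \in X -> v \in Z -> X = Z.
Proof.
move=> bX bZ vX vZ; apply/setP.
apply: (connected_ind (v := v)) => [|x y exy]; first by rewrite vX vZ.
by have := bX _ _ exy; have := bZ _ _ exy; do 4!case: (_ \in _).
Qed.

End Connected.

Lemma deg_le_max (T : finType) (e : rel T) (x : T) : deg e x <= max_deg e.
Proof. exact: (leq_bigmax (F := deg e) x). Qed.

Lemma ex_max_deg (T : finType) (e : rel T) :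
  0 < #|T| -> exists v, deg e v = max_deg e.
Proof.
by case/card_gt0P => x0 _; rewrite /max_deg (bigmax_eq_arg x0) //; eexists.
Qed.

Lemma complete_bipartite_iso (T : finType) (e : rel T) (X : {set T}) (p q : nat) :
  symmetric e -> bipartition_part e X ->
  (forall x y, x \in X -> y \notin X -> e x y) ->
  #|~: X| = p -> #|X| = q -> graph_iso e (@complete_bipartite p q).
Proof.
move=> e_sym bX full <- <-.
pose h (x : T) : 'I_#|~: X| + 'I_#|X| :=
  match boolP (x \in X) with
  | AltTrue xX => inr (enum_rank_in xX x)
  | AltFalse xX => inl (enum_rank_in (etrans (in_setC x X) xX) x)
  end.
pose g (s : 'I_#|~: X| + 'I_#|X|) : T :=
  match s with inl i => enum_val i | inr i => enum_val i end.
have hg : cancel h g.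
  move=> x; rewrite /h; case: {-}_ / boolP => xX /=; apply: enum_rankK_in => //.
  by rewrite inE.
exists h.
  (* [g] is only shown to be a left inverse; bijectivity then follows from the cardinalities. *)
  apply: inj_card_bij; first exact: can_inj hg.
  by rewrite card_sum !card_ord cardsCs setCK addnC; have := cardsC X; lia.
move=> x y; rewrite /h.
case: {-}_ / (boolP (x \in X)) => xX; case: {-}_ / (boolP (y \in X)) => yX /=.
- by apply/esym/negP => /bX; rewrite xX yX.
- by rewrite full.
- by rewrite e_sym full.
- by apply/esym/negP => /bX; rewrite (negbTE xX) (negbTE yX).
Qed.

(** * Levels in a connected [k]-SI graph *)

Section StepwiseIrregular.
Context (k : nat) (T : finType) (e : rel T).
Hypotheses (k_gt0 : 0 < k) (e_sym : symmetric e) (e_conn : connected_graph e).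
Hypotheses (T_ge2 : 2 <= #|T|) (e_SI : k_SI k e).

Let D := max_deg e.

(** Neither the subtraction nor the division loses anything, by [deg_level]. *)
Definition level (x : T) : nat := (D - deg e x) %/ k.

Lemma SI_step (x y : T) :
  e x y -> deg e x = deg e y + k \/ deg e y = deg e x + k.
Proof. by move/e_SI; lia. Qed.

Lemma deg_gt0 (x : T) : 0 < deg e x.
Proof.
have [y exy] := connected_neighbor e_conn x T_ge2.
by apply/card_gt0P; exists y; rewrite inE.
Qed.

Lemma deg_level (x : T) : deg e x + level x * k = D.
Proof.
have [v dv] := ex_max_deg e (ltnW T_ge2).
suff [j jE] : exists j, deg e x + j * k = D.
  by rewrite /level -jE addKn mulnK.
move: x; apply: (connected_ind e_conn (v := v)) => [|x y exy [j jE]].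
  by exists 0; rewrite dv addn0.
have [E|E] := SI_step exy; first by exists j.+1; rewrite mulSn -jE E; lia.
(* A rise in degree lowers the index by one; from index 0 it would lead to degree [D + k]. *)
case: j jE => [|j] jE; last by exists j; rewrite E -jE mulSn; lia.
by have := deg_le_max e y; rewrite -/D; lia.
Qed.

Lemma level_step (x y : T) : e x y -> level x = (level y).+1 \/ level y = (level x).+1.
Proof. by move=> /SI_step; have := deg_level x; have := deg_level y; nia. Qed.

Lemma bipartition_even_level : bipartition_part e [set x | ~~ odd (level x)].
Proof.
by move=> x y /level_step[]; rewrite !inE => -> /=; case: (odd _).
Qed.

(** * The part containing a vertex of maximum degree *)

Section MaxPart.
Context (X : {set T}) (v : T).
Hypotheses (bX : bipartition_part e X) (vX : v \in X) (dv : deg e v = D).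

Lemma mem_even_level (x : T) : (x \in X) = ~~ odd (level x).
Proof.
rewrite (bipartition_part_unique e_conn bX bipartition_even_level vX) ?inE //.
by rewrite /level dv subnn div0n.
Qed.

Lemma level_notin_gt0 (y : T) : y \notin X -> 0 < level y.
Proof. by rewrite mem_even_level; case: (level y). Qed.

Lemma deg_notin (y : T) : y \notin X -> deg e y + k <= D.
Proof. by move=> /level_notin_gt0; have := deg_level y; nia. Qed.

Lemma max_deg_gt : k < D.
Proof.
have [w evw] := connected_neighbor e_conn v T_ge2.
have /deg_notin : w \notin X by have := bX evw; rewrite vX; case: (w \in X).
by have := deg_gt0 w; lia.
Qed.

Lemma neighbors_part (y : T) : y \notin X -> [set x | e y x] \subset X.
Proof.
move=> yX; apply/subsetP => x; rewrite inE => /bX.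
by rewrite (negbTE yX); case: (x \in X).
Qed.

Lemma neighbor_max (w : T) : e v w -> w \notin X /\ deg e w = D - k.
Proof.
move=> evw; have wX : w \notin X by have := bX evw; rewrite vX; case: (w \in X).
by split => //; have := deg_notin wX; have := SI_step evw; lia.
Qed.

Lemma card_max_part_ge : D - k <= #|X|.
Proof.
have [w /neighbor_max[wX <-]] := connected_neighbor e_conn v T_ge2.
exact/subset_leq_card/neighbors_part.
Qed.

Lemma neighbors_full (y : T) :
  #|X| = D - k -> y \notin X -> deg e y = D - k -> forall x, x \in X -> e x y.
Proof.
move=> cX yX dy x xX.
have /eqP E : [set x | e y x] == X by rewrite eqEcard neighbors_part // cX -dy /=.
by rewrite e_sym; move: xX; rewrite -E inE.
Qed.

Lemma small_max_part_iso :
  #|X| = D - k -> graph_iso e (@complete_bipartite D (D - k)).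
Proof.
move=> cX.
(* Each neighbour of [v] has degree [D - k = #|X|], so it is joined to all of [X]; hence [x] has at
   least the [D] neighbours of [v]. *)
have Xdeg x : x \in X -> deg e x = D.
  move=> xX; apply/eqP; rewrite eqn_leq deg_le_max /= -dv.
  apply/subset_leq_card/subsetP => w; rewrite !inE => /neighbor_max[wX dw].
  exact: neighbors_full.
have Ydeg y : y \notin X -> deg e y = D - k.
  move=> yX; have [x eyx] := connected_neighbor e_conn y T_ge2.
  have xX : x \in X by have := bX eyx; rewrite (negbTE yX); case: (x \in X).
  by have := Xdeg _ xX; have := deg_notin yX; have := SI_step eyx; lia.
have full x y : x \in X -> y \notin X -> e x y.
  by move=> xX yX; apply: neighbors_full => //; apply: Ydeg.
apply: (complete_bipartite_iso e_sym bX full) => //.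
rewrite -dv; apply: eq_card => y; rewrite !inE.
have [yX|yX] := boolP (y \in X); last by rewrite full.
by apply/esym/negP => /bX; rewrite vX yX.
Qed.

(** The sum records how far degrees outside [X] fall short of their upper bound [D - k]; the size
    bound is attained exactly when it vanishes. *)
Lemma size_sum_notin :
  #|edges e| + \sum_(y in ~: X) (D - k - deg e y) = (D - k) * #|~: X|.
Proof.
rewrite (card_edges_bipartition e_sym (bipartition_partC bX)) -big_split /=.
rewrite mulnC -sum_nat_const; apply: eq_bigr => y; rewrite inE => /deg_notin; lia.
Qed.

Lemma size_le : #|edges e| <= (D - k) * #|~: X|.
Proof. by rewrite -size_sum_notin leq_addr. Qed.

Lemma size_eq :
  #|edges e| = (D - k) * #|~: X| <-> forall y, y \notin X -> level y = 1.
Proof.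
have dE y : y \notin X -> (D - k - deg e y == 0) = (level y == 1).
  move=> yX; have := level_notin_gt0 yX; have := deg_level y.
  by have := max_deg_gt; nia.
have -> : #|edges e| = (D - k) * #|~: X| <-> \sum_(y in ~: X) (D - k - deg e y) == 0.
  by split; have := size_sum_notin; lia.
rewrite sum_nat_eq0; split=> [/forallP h y yX|h].
  by have := h y; rewrite inE yX dE // => /eqP.
by apply/forallP => y; rewrite inE; apply/implyP => yX; rewrite dE // h.
Qed.

Lemma max_part_level2 :
  coprime D k -> #|X| = (D - k).+1 -> (forall y, y \notin X -> level y = 1) ->
  exists2 x, x \in X & level x = 2.
Proof.
move=> co cX Y1; case: (boolP [exists x in X, level x == 2]) => [/exists_inP|].
  by case=> x xX /eqP x2; exists x.
move=> /exists_inPn X2; exfalso.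
have Dk := max_deg_gt.
(* A vertex of [X] has a neighbour of level 1, so its level is 0 or 2, and 2 is excluded. *)
have Xdeg x : x \in X -> deg e x = D.
  move=> xX; have [y exy] := connected_neighbor e_conn x T_ge2.
  have yX : y \notin X by have := bX exy; rewrite xX; case: (y \in X).
  have := Y1 _ yX; have := X2 _ xX; have := level_step exy; have := deg_level x.
  by case: (level x) => [|[|[]]] //=; lia.
have mX : #|edges e| = D * (D - k).+1.
  rewrite (card_edges_bipartition e_sym bX) (eq_bigr (fun => D)) //.
  by rewrite sum_nat_const cX mulnC.
have [_ /(_ Y1) mY] := size_eq.
(* [D - k] is coprime to [D] and divides [D * (D - k).+1], hence divides [(D - k).+1], hence 1. *)
have d1 : D - k = 1.
  have cd : coprime (D - k) D.
    rewrite -[X in coprime _ X](subnK (ltnW Dk)) /coprime gcdnDl gcdnC.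
    by rewrite -gcdnDr subnK ?(ltnW Dk) // gcdnC.
  have : D - k %| D * (D - k).+1 by rewrite -mX mY dvdn_mulr.
  by rewrite Gauss_dvdr // -addn1 dvdn_addr // dvdn1 => /eqP.
(* All neighbours of [v] are leaves, so no walk from [v] leaves the star around it. *)
have cover x : x = v \/ e v x.
  move: x; apply: (connected_ind e_conn (v := v)) => [|x y exy [xv|evx]]; first by left.
    by right; rewrite -xv.
  left; have [xX dx] := neighbor_max evx.
  have /cards1P[z Nx] : #|[set z | e x z]| == 1 by rewrite -[#|_|]/(deg e x) dx d1.
  have : y \in [set z | e x z] by rewrite inE.
  have : v \in [set z | e x z] by rewrite inE e_sym.
  by rewrite Nx !inE => /eqP -> /eqP.
have : #|X| <= #|[set v]|.
  apply/subset_leq_card/subsetP => x xX; rewrite inE.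
  by case: (cover x) => [->//|/bX]; rewrite vX xX.
by rewrite cX d1 cards1.
Qed.

(** A discrete intermediate value argument: levels start at 0 in [v] and change by one along each
    edge. *)
Lemma ex_level2 (x : T) : 2 <= level x -> exists z, level z = 2.
Proof.
move: x; apply: (connected_ind e_conn (v := v)) => [|x y exy IHx y2].
  by rewrite /level dv subnn div0n.
have [/IHx //|x1] := leqP 2 (level x).
by exists y; have := level_step exy; lia.
Qed.

(** Distinct levels are distinct degrees, and levels 0 and 1 always occur. A vertex outside [X] not
    of level 1 has level at least 3, which forces level 2 as well and so a fourth degree.
    Conversely, [max_part_level2] supplies the third degree. *)
Lemma deg_complexity_eq3 :
  coprime D k -> #|X| = (D - k).+1 ->
  deg_complexity e = 3 <-> forall y, y \notin X -> level y = 1.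
Proof.
move=> co cX.
have v0 : level v = 0 by rewrite /level dv subnn div0n.
have [w evw] := connected_neighbor e_conn v T_ge2.
have w1 : level w = 1 by have := level_step evw; lia.
have degM x : deg e x \in undup [seq deg e x | x : T].
  by rewrite mem_undup; apply: map_f; rewrite mem_enum.
have [Lv Lw] := (deg_level v, deg_level w); rewrite v0 w1 in Lv Lw.
split=> [C3 y yX|Y1].
  have := level_notin_gt0 yX; have := mem_even_level y; rewrite (negbTE yX).
  case ly: (level y) => [|[|[|j]]] // _ _.
  have [z z2] : exists z, level z = 2 by apply: (ex_level2 (x := y)); rewrite ly.
  have [Lz Ly] := (deg_level z, deg_level y); rewrite z2 ly in Lz Ly.
  have : uniq [:: deg e v; deg e w; deg e z; deg e y].
    by rewrite /= !inE; nia.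
  move/uniq_leq_size => /(_ (undup [seq deg e x | x : T])).
  rewrite -/(deg_complexity e) C3 /= => leq43; suff : 4 <= 3 by [].
  by apply: leq43 => d; rewrite !inE => /or4P[] /eqP ->.
have [z zX z2] := max_part_level2 co cX Y1.
have Lz := deg_level z; rewrite z2 in Lz.
rewrite /deg_complexity; apply: (perm_size (s2 := [:: deg e v; deg e w; deg e z])).
apply: uniq_perm; [exact: undup_uniq | by rewrite /= !inE; nia |] => d.
apply/idP/idP; last by rewrite !inE => /or3P[] /eqP ->.
rewrite mem_undup => /mapP[x _ ->]; rewrite !inE.
have Lx := deg_level x.
suff : level x <= 2 by case: (level x) Lx => [|[|[]]] // Lx _; lia.
have [xX|/Y1 -> //] := boolP (x \in X).
have [y exy] := connected_neighbor e_conn x T_ge2.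
have /Y1 : y \notin X by have := bX exy; rewrite xX; case: (y \in X).
by have := level_step exy; lia.
Qed.

End MaxPart.
End StepwiseIrregular.

Theorem theorem5p4 (k : nat) (T : finType) (e : rel T)
    (k_ge1 : 1 <= k)
    (e_simple : simple_graph e)
    (e_conn : connected_graph e)
    (T_ge2 : 2 <= #|T|)
    (e_SI : k_SI k e)
    (e_notK : ~ graph_iso e (@complete_bipartite (max_deg e) (max_deg e - k)))
    (e_coprime : coprime (max_deg e) k) :
  let n : int := #|T|%:Z%R in
  let m : int := #|edges e|%:Z%R in
  let D : int := (max_deg e)%:Z%R in
  (m <= (D - k%:Z) * (n - D + k%:Z - 1))%R
  /\ forall X : {set T}, bipartition_part e X ->
       (exists2 v : T, v \in X & deg e v = max_deg e) ->
       ((m = (D - k%:Z) * (n - D + k%:Z - 1))%R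
        <-> deg_complexity e = 3 /\ (#|X|%:Z = D - k%:Z + 1)%R).
Proof.
have [e_sym _] := e_simple.
have bound X v : bipartition_part e X -> v \in X -> deg e v = max_deg e ->
    max_deg e - k < #|X| /\ #|edges e| <= (max_deg e - k) * #|~: X|.
  move=> bX vX dv; split; last exact: (size_le k_ge1 e_sym e_conn T_ge2 e_SI bX vX dv).
  have := card_max_part_ge k_ge1 e_conn T_ge2 e_SI bX vX dv.
  rewrite leq_eqVlt => /orP[/eqP cX|//]; case: e_notK.
  exact: (small_max_part_iso k_ge1 e_sym e_conn T_ge2 e_SI bX vX dv).
have [v0 dv0] := ex_max_deg e (ltnW T_ge2).
have v0X : v0 \in [set x | ~~ odd (level k e x)].
  by rewrite inE /level dv0 subnn div0n.
have bX0 := bipartition_even_level k_ge1 e_conn T_ge2 e_SI.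
have Dk := max_deg_gt k_ge1 e_conn T_ge2 e_SI bX0 v0X dv0.
split=> [|X bX [v vX dv]].
  have [cX mX] := bound _ _ bX0 v0X dv0.
  have := cardsC [set x | ~~ odd (level k e x)].
  move: cX mX; set a := #|_|; set b := #|_|; nia.
have [cX mX] := bound _ _ bX vX dv; have nX := cardsC X.
have sizeE := size_eq k_ge1 e_sym e_conn T_ge2 e_SI bX vX dv.
have compE := deg_complexity_eq3 k_ge1 e_sym e_conn T_ge2 e_SI bX vX dv e_coprime.
split=> [mE|[C3 cXE]].
  (* As [D - k] is positive, a larger [X] would make the bound [mX] strictly smaller than the
     assumed size. *)
  have cXE : #|X| = (max_deg e - k).+1 by nia.
  split; last by lia.
  by apply/compE => //; apply/sizeE; nia.
have cX1 : #|X| = (max_deg e - k).+1 by lia.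
have mE : #|edges e| = (max_deg e - k) * #|~: X|.
  by apply/sizeE; apply/compE.
nia.
Qed.
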